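(* Let $I$ be a set, let $R,S\subseteq I\times I$, and put $M_R=[a_{ij}]$, $M_S=[b_{ij}]$ and $A_i:=\{j\in I\mid a_{ij}=1\}$ for $i\in I$. Then the following are equivalent: (i) The equation $R\circ X=S$ has a solution $X\subseteq I\times I$. (ii) There exists a family $(X_k)_{k\in I}$ of subsets of $I$ such that $\max_{l\in X_k}\vec a_l=\vec b_k$ for all $k\in I$. (iii) There exists a family $(X_k)_{k\in I}$ of subsets of $I$ such that for all $i,k\in I$ we have $A_i\cap X_k=\emptyset$ if and only if $b_{ik}=0$. Moreover, for any family $(X_k)_{k\in I}$ as in (ii), $X=\{(i,j)\mid j\in I,\ i\in X_j\}$ is a solution of $R\circ X=S$, and all solutions can be obtained in this way.
   Context: For a relation $R\subseteq I\times I$, its incidence matrix $M_R=[a_{ij}]$ is the mapping $I\times I\to\{0,1\}$ with $a_{ij}=1$ if $(i,j)\in R$ and $a_{ij}=0$ otherwise. Composition of relations is $R\circ X=\{(x,y)\in I\times I\mid \text{there exists } z\in I \text{ with } (x,z)\in R \text{ and } (z,y)\in X\}$. For an $I\times I$-matrix $[a_{ij}]$ over $\{0,1\}$, the $k$-th column is $\vec a_k:=(a_{ik})_{i\in I}$ for $k\in I$, and for $J\subseteq I$ one puts $\max_{k\in J}\vec a_k:=(\max_{k\in J}a_{ik})_{i\in I}$, with the convention $\max_{k\in\emptyset}\vec a_k:=(0)_{i\in I}$. Likewise $\vec b_k$ denotes the $k$-th column of $M_S=[b_{ij}]$. *)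

(* Defs.v *)
From mathcomp Require Import all_boot all_order.
From mathcomp Require Import boolp classical_sets.

Set Implicit Arguments.
Unset Strict Implicit.
Unset Printing Implicit Defensive.

Local Open Scope classical_set_scope.

(* Matrices over {0,1} are functions I -> I -> bool, with 0 = false and
   1 = true; MathComp orders bool by false < true. *)

Definition incidence {I : Type} (R : set (I * I)) : I -> I -> bool :=
  fun i j => `[< R (i, j) >].

(* [(X \; R)%relation] is {(x, y) | exists z, (x, z) in R and (z, y) in X}:
   the right operand acts first, so R o X is written [X \; R]. *)
Definition rel_comp {I : Type} (R X : set (I * I)) : set (I * I) :=
  (X \; R)%relation.

Definition column {I : Type} (M : I -> I -> bool) (k : I) : I -> bool :=
  fun i => M i k.

(* The entrywise maximum of the columns indexed by J, as a supremum in bool,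
   where every nonempty set has a greatest element; the default value [false]
   of [supremum] on the empty set is the convention for J empty. *)
Definition max_columns {I : Type} (M : I -> I -> bool) (J : set I) : I -> bool :=
  fun i => supremum false [set column M k i | k in J].

Definition row_support {I : Type} (M : I -> I -> bool) (i : I) : set I :=
  [set j | M i j = true].

Definition rel_of_family {I : Type} (F : I -> set I) : set (I * I) :=
  [set p | F p.2 p.1].

(* Main.v *)
(* Entry by entry, (ii), (iii) and the equation R o {(i, j) | i in F j} = S all
   say that b_ik = 1 if and only if A_i meets F k, and every relation X has the
   form {(i, j) | i in F j}, with F j = {i | (i, j) in X}. *)

Require Import Defs.
From mathcomp Require Import all_boot all_order.
From mathcomp Require Import boolp classical_sets.

Local Open Scope classical_set_scope.

(** Since [true] is the top of [bool], a set containing it has supremum [true]. Any other set is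
    empty, where the default [false] applies, or contains only [false]. *)
Lemma supremum_bool (A : set bool) : supremum false A = `[< A true >].
Proof.
have [/eqP A0|/set0P An0] := boolP (A == set0).
  by rewrite A0 supremum0; apply/esym/asboolPn.
rewrite /supremum ifF; last by apply/negbTE/set0P.
(* Least upper bounds are unique, so exhibiting one determines the value chosen by [xget]. *)
suff AsupA : supremums A `[< A true >].
  by apply: xget_subset1 => //; exact: is_subset1_supremums.
split=> [[] // At|b]; first by rewrite asboolT.
by case: asboolP => // At; apply.
Qed.

Lemma max_columnsP (I : Type) (M : I -> I -> bool) (J : set I) (i : I) :
  reflect (exists2 k, J k & M i k) (max_columns M J i).
Proof.
by rewrite /max_columns supremum_bool; apply: (iffP (asboolP _));
  move=> [k Jk Mik]; exists k.
Qed.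

Lemma setI_row_support_eq0 (I : Type) (M : I -> I -> bool) (J : set I) (i : I) :
  row_support M i `&` J = set0 <-> max_columns M J i = false.
Proof.
split=> [MJ0|/negbT /max_columnsP nM].
  (* [False] is recast as membership in [set0], which [MJ0] turns back into the intersection. *)
  by apply/negbTE/max_columnsP => -[k Jk Mik]; rewrite -[False]/(set0 k) -MJ0.
by rewrite -subset0 => k [Mik Jk]; apply: nM; exists k.
Qed.

(** Read forwards, this turns a family into a solution; read backwards, it shows that the family of
    a given solution satisfies (ii). *)
Lemma max_columns_eqP (I : Type) (R S : set (I * I)) (F : I -> set I) :
  (forall k, max_columns (incidence R) (F k) = column (incidence S) k) <->
  rel_comp R (rel_of_family F) = S.
Proof.
split=> [maxE|<- k].
  have SE i k : S (i, k) <-> max_columns (incidence R) (F k) i.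
    by rewrite maxE; split=> /asboolP.
  apply/seteqP; split=> -[i k] /=.
    move=> [j Rij Fkj]; apply/SE/max_columnsP.
    by exists j => //; apply/asboolP.
  by move=> /SE/max_columnsP[j Fkj /asboolP Rij]; exists j.
apply/funext => i; apply/max_columnsP/asboolP => [[j Fkj /asboolP Rij]|].
  by exists j.
by move=> [j Rij Fkj]; exists j => //; apply/asboolP.
Qed.

Theorem theorem11 (I : Type) (R S : set (I * I)) :
  let a := incidence R in
  let b := incidence S in
  let A := row_support a in
  let cond_i := exists X : set (I * I), rel_comp R X = S in
  let cond_ii (F : I -> set I) :=
    forall k : I, max_columns a (F k) = column b k in
  let cond_iii (F : I -> set I) :=
    forall i k : I, A i `&` F k = set0 <-> b i k = false in
  [/\ cond_i <-> (exists F : I -> set I, cond_ii F),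
      (exists F : I -> set I, cond_ii F) <-> (exists F : I -> set I, cond_iii F),
      (forall F : I -> set I, cond_ii F -> rel_comp R (rel_of_family F) = S) &
      (forall X : set (I * I), rel_comp R X = S ->
         exists F : I -> set I, cond_ii F /\ X = rel_of_family F)].
Proof.
move=> a b A cond_i cond_ii cond_iii.
have solP (X : set (I * I)) : rel_comp R X = S ->
    exists F : I -> set I, cond_ii F /\ X = rel_of_family F.
  have -> : X = rel_of_family (fun k => [set i | X (i, k)]).
    by apply/seteqP; split=> -[].
  by move=> /max_columns_eqP XS; exists (fun k => [set i | X (i, k)]).
(* The equivalence holds family by family, so (ii) and (iii) have the same witnesses. *)
have iiP F : cond_ii F <-> cond_iii F.
  split=> [iiF i k|iiiF k]; first by rewrite setI_row_support_eq0 iiF.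
  (* Two booleans that are [false] under the same conditions are equal; each mixed case contradicts
     one direction of (iii). *)
  apply/funext => i; have := iiiF i k; rewrite setI_row_support_eq0 /column.
  by case: max_columns (b i k) => -[] // [] => [_ /(_ erefl)|/(_ erefl)].
split=> //; last by move=> F /max_columns_eqP.
- split=> [[X /solP[F [iiF _]]]|[F /max_columns_eqP RF]]; first by exists F.
  by exists (rel_of_family F).
- by split=> -[F /iiP HF]; exists F.
Qed.
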